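(* There exist absolute constants $\alpha>1$ and $c>0$ (independent of the dimension $n$ and of the family) with the following property: if $\{P_i : i\in I\}$ is a finite family of convex bodies in $\mathbb{R}^n$ with $\operatorname{int}\left(\bigcap_{i\in I}P_i\right)\neq\emptyset$, then there exist $z\in\mathbb{R}^n$, a natural number $s\leq \alpha n$ and indices $i_1,\ldots,i_s\in I$ such that $$z+\left(P_{i_1}\cap\cdots\cap P_{i_s}\right)\subseteq c\,n^{3/2}\left(z+\bigcap_{i\in I}P_i\right).$$
   Context: A convex body in $\mathbb{R}^n$ is a compact convex subset of $\mathbb{R}^n$ with non-empty interior. For a set $K\subseteq\mathbb{R}^n$, $z\in\mathbb{R}^n$ and $t>0$, $z+K=\{z+x : x\in K\}$ and $tK=\{tx : x\in K\}$. Here $\operatorname{int}$ denotes the topological interior in $\mathbb{R}^n$. *)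

(* Defs.v *)
From mathcomp Require Import all_boot all_order all_algebra.
From mathcomp Require Import all_classical all_reals all_analysis.

Set Implicit Arguments.
Unset Strict Implicit.
Unset Printing Implicit Defensive.

Import Order.TTheory GRing.Theory Num.Theory.
Import numFieldNormedType.Exports.

Local Open Scope classical_set_scope.
Local Open Scope ring_scope.

(* The norm of 'rV[R]_n is the sup norm; its topology is the usual one of R^n. *)
Definition convex_body (R : realType) (n : nat) (K : set 'rV[R]_n) : Prop :=
  [/\ convex_set K, compact K & K° !=set0].

Definition translate (R : realType) (n : nat) (z : 'rV[R]_n)
    (K : set 'rV[R]_n) : set 'rV[R]_n :=
  [set z + x | x in K].

Definition dilate (R : realType) (n : nat) (t : R)
    (K : set 'rV[R]_n) : set 'rV[R]_n :=
  [set t *: x | x in K].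

(* Main.v *)
(* Apply an affine map taking an ellipsoid of maximal volume inscribed in the
   intersection P to the unit ball, and let V be the union of the polars of the
   bodies. Maximality implies that each quadratic test function v M v + <v, y> has
   a value on V at least tr M / n, up to an arbitrarily small error: this dual form
   of John's decomposition of the identity is all that is needed.
   A one-sided Batson-Spielman-Srivastava barrier argument selects 40 n vectors v
   of V with weights s in [0, 1] such that sum s v^T v >= 1; a term |w|^2 added to
   the potential keeps w = sum s v of norm O(sqrt n). As V has a point v with
   <y, v> >= 1 / 2n for each unit vector y, Frank-Wolfe iterations with Caratheodory
   reductions approximate - w / O(n^(3/2)) by a convex combination of n + 1 further
   points of V. If <x, v> <= 1 for all the selected v, then
   |x|^2 <= sum s <x, v>^2 <= |x| sum s (2 - <x, v>) = |x| (O(n) - <x, w>),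
   where - <x, w> = O(n^(3/2)), so that x lies in O(n^(3/2)) P. *)
Require Import Defs.
From mathcomp Require Import all_boot all_order all_algebra.
From mathcomp Require Import all_classical all_reals all_analysis.
From mathcomp Require Import ring lra zify.
Import Order.TTheory GRing.Theory Num.Theory.
Import numFieldNormedType.Exports.
Local Open Scope classical_set_scope.
Local Open Scope ring_scope.

Set Implicit Arguments.
Unset Strict Implicit.
Unset Printing Implicit Defensive.

(** * Euclidean inner product *)

(** Rows carry the sup norm, so Euclidean lengths are expressed by this product; its matrix form
    lets adjoints and rank-one matrices be moved by associativity. *)
Definition dot {R : realType} {n : nat} (x y : 'rV[R]_n) : R := (x *m y^T) 0 0.

Lemma dotE (R : realType) (n : nat) (x y : 'rV[R]_n) :
  dot x y = \sum_j x 0 j * y 0 j.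
Proof. by rewrite /dot mxE; apply: eq_bigr => j _; rewrite mxE. Qed.

Lemma dotC (R : realType) (n : nat) (x y : 'rV[R]_n) : dot x y = dot y x.
Proof. by rewrite !dotE; apply: eq_bigr => j _; rewrite mulrC. Qed.

Lemma dotDl (R : realType) (n : nat) (x y z : 'rV[R]_n) :
  dot (x + y) z = dot x z + dot y z.
Proof. by rewrite /dot mulmxDl mxE. Qed.

Lemma dotDr (R : realType) (n : nat) (x y z : 'rV[R]_n) :
  dot z (x + y) = dot z x + dot z y.
Proof. by rewrite dotC dotDl !(dotC z). Qed.

Lemma dotZl (R : realType) (n : nat) (a : R) (x y : 'rV[R]_n) :
  dot (a *: x) y = a * dot x y.
Proof. by rewrite /dot -scalemxAl mxE. Qed.

Lemma dotZr (R : realType) (n : nat) (a : R) (x y : 'rV[R]_n) :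
  dot x (a *: y) = a * dot x y.
Proof. by rewrite dotC dotZl dotC. Qed.

Lemma dotNl (R : realType) (n : nat) (x y : 'rV[R]_n) : dot (- x) y = - dot x y.
Proof. by rewrite -scaleN1r dotZl mulN1r. Qed.

Lemma dotNr (R : realType) (n : nat) (x y : 'rV[R]_n) : dot x (- y) = - dot x y.
Proof. by rewrite dotC dotNl dotC. Qed.

Lemma dot0l (R : realType) (n : nat) (x : 'rV[R]_n) : dot 0 x = 0.
Proof. by rewrite -(scale0r 0) dotZl mul0r. Qed.

Lemma dot0r (R : realType) (n : nat) (x : 'rV[R]_n) : dot x 0 = 0.
Proof. by rewrite dotC dot0l. Qed.

Definition dot_lin := (dotDl, dotDr, dotZl, dotZr, dotNl, dotNr, dot0l, dot0r).

Lemma dot_sumr (R : realType) (n : nat) (I : Type) (r : seq I)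
    (F : I -> 'rV[R]_n) (x : 'rV[R]_n) :
  dot x (\sum_(i <- r) F i) = \sum_(i <- r) dot x (F i).
Proof. by apply: (big_morph (dot x)) => [u v|]; rewrite dot_lin. Qed.

Lemma dot_mulmx (R : realType) (n : nat) (M : 'M[R]_n) (x y : 'rV[R]_n) :
  dot (x *m M) y = dot x (y *m M^T).
Proof. by rewrite /dot trmx_mul trmxK mulmxA. Qed.

Lemma dot_symC (R : realType) (n : nat) (M : 'M[R]_n) (x y : 'rV[R]_n) :
  M^T = M -> dot (x *m M) y = dot (y *m M) x.
Proof. by move=> sM; rewrite dot_mulmx sM dotC. Qed.

Lemma dot_ge0 (R : realType) (n : nat) (x : 'rV[R]_n) : 0 <= dot x x.
Proof. by rewrite dotE sumr_ge0 // => j _; rewrite -expr2 sqr_ge0. Qed.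

Lemma dot_eq0 (R : realType) (n : nat) (x : 'rV[R]_n) : (dot x x == 0) = (x == 0).
Proof.
apply/eqP/eqP => [|->]; last by rewrite dot0l.
rewrite dotE => /eqP; rewrite psumr_eq0; last by move=> j _; rewrite -expr2 sqr_ge0.
move=> /allP x0; apply/rowP => j; rewrite mxE; apply/eqP.
by have := x0 j (mem_index_enum _); rewrite -expr2 sqrf_eq0.
Qed.

Lemma dot_gt0 (R : realType) (n : nat) (x : 'rV[R]_n) : x != 0 -> 0 < dot x x.
Proof. by move=> x0; rewrite lt_neqAle eq_sym dot_eq0 x0 dot_ge0. Qed.

(** The quadratic is evaluated at its minimiser [- b / c]; for [c = 0] it is affine and would take
    the value [-1] if [b] were nonzero. *)
Lemma discriminant_le (R : realType) (a b c : R) :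
  0 <= c -> (forall t, 0 <= a + 2 * t * b + t ^+ 2 * c) -> b ^+ 2 <= a * c.
Proof.
rewrite le_eqVlt => /predU1P[<-|c0] H.
  have [->|b0] := eqVneq b 0; first by rewrite expr0n mulr0.
  have := H (- (a + 1) / (2 * b)).
  suff -> : a + 2 * (- (a + 1) / (2 * b)) * b + (- (a + 1) / (2 * b)) ^+ 2 * 0 = -1 by lra.
  by field.
have := H (- b / c).
have -> : a + 2 * (- b / c) * b + (- b / c) ^+ 2 * c = (a * c - b ^+ 2) / c.
  by field; rewrite gt_eqF.
by rewrite pmulr_lge0 ?invr_gt0 // subr_ge0.
Qed.

Lemma psd_cauchy (R : realType) (n : nat) (M : 'M[R]_n) (x y : 'rV[R]_n) :
  M^T = M -> (forall z, 0 <= dot (z *m M) z) ->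
  dot (x *m M) y ^+ 2 <= dot (x *m M) x * dot (y *m M) y.
Proof.
move=> sM pM; apply: discriminant_le => // t.
have := pM (x + t *: y).
rewrite mulmxDl -scalemxAl !dot_lin (dot_symC y x sM).
by congr (_ <= _); ring.
Qed.

Lemma cauchy_schwarz (R : realType) (n : nat) (x y : 'rV[R]_n) :
  dot x y ^+ 2 <= dot x x * dot y y.
Proof.
have := @psd_cauchy R n 1%:M x y (trmx1 _ _); rewrite !mulmx1; apply => z.
by rewrite mulmx1 dot_ge0.
Qed.

Lemma dot_delta (R : realType) (n : nat) (M : 'M[R]_n) (i : 'I_n) :
  dot (delta_mx 0 i *m M) (delta_mx 0 i) = M i i.
Proof. by rewrite -rowE /dot trmx_delta -colE !mxE. Qed.

Lemma mxtrace_rank1 (R : realType) (n : nat) (x y : 'rV[R]_n) :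
  \tr (x^T *m y) = dot x y.
Proof. by rewrite mxtrace_mulC dotC [LHS]big_ord1. Qed.

Lemma dot_rank1 (R : realType) (n : nat) (x u v y : 'rV[R]_n) :
  dot (x *m (u^T *m v)) y = dot x u * dot v y.
Proof.
by rewrite mulmxA /dot (mx11_scalar (x *m u^T)) mul_scalar_mx -scalemxAl mxE !mxE eqxx mulr1n.
Qed.

(** * Positive definite matrices *)

Definition posdef {R : realType} {n : nat} (M : 'M[R]_n) : Prop :=
  M^T = M /\ forall x, x != 0 -> 0 < dot (x *m M) x.

Lemma posdef_ge0 (R : realType) (n : nat) (M : 'M[R]_n) (x : 'rV[R]_n) :
  posdef M -> 0 <= dot (x *m M) x.
Proof.
move=> [_ pM]; have [->|x0] := eqVneq x 0; first by rewrite dot0r.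
by rewrite ltW // pM.
Qed.

Lemma posdef_unit (R : realType) (n : nat) (M : 'M[R]_n) :
  posdef M -> M \in unitmx.
Proof.
move=> [_ pM]; rewrite unitmxE unitfE; apply/negP => /det0P[v v0 vM].
by have := pM v v0; rewrite vM dot0l ltxx.
Qed.

Lemma posdef_inv (R : realType) (n : nat) (M : 'M[R]_n) :
  posdef M -> posdef (invmx M).
Proof.
move=> pM; have uM := posdef_unit pM; case: (pM) => sM p; split => [|x x0].
  by rewrite trmx_inv sM.
have -> : dot (x *m invmx M) x = dot (x *m invmx M *m M) (x *m invmx M).
  by rewrite mulmxKV // dotC.
apply: p; apply: contra_neq x0 => x0.
by rewrite -(mulmxKV uM x) x0 mul0mx.
Qed.

Lemma posdef_cauchy (R : realType) (n : nat) (M : 'M[R]_n) (x y : 'rV[R]_n) :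
  posdef M -> dot (x *m M) y ^+ 2 <= dot (x *m M) x * dot (y *m M) y.
Proof. by move=> pM; apply: psd_cauchy => [|z]; [case: pM|apply: posdef_ge0]. Qed.

Lemma mxtrace_dot (R : realType) (n : nat) (M : 'M[R]_n) :
  \tr M = \sum_i dot (delta_mx 0 i *m M) (delta_mx 0 i).
Proof. by apply: eq_bigr => i _; rewrite dot_delta. Qed.

(** A lower bound for the least eigenvalue without diagonalisation: each coordinate of [x] is the
    [M]-product of [x] with [e *m invmx M], and the Cauchy-Schwarz bounds of the squares sum to the
    trace. *)
Lemma posdef_trace_inv_ge (R : realType) (n : nat) (M : 'M[R]_n) (x : 'rV[R]_n) :
  posdef M -> dot x x <= \tr (invmx M) * dot (x *m M) x.
Proof.
move=> pM; have uM := posdef_unit pM; have [sM _] := pM.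
have [sY _] := posdef_inv pM.
rewrite mxtrace_dot mulr_suml dotE; apply: ler_sum => i _.
set e := delta_mx 0 i.
have -> : x 0 i = dot (x *m M) (e *m invmx M).
  rewrite dot_mulmx sM mulmxKV // dotE (bigD1 i) //= big1 => [|j ji].
    by rewrite mxE !eqxx mulr1 addr0.
  by rewrite mxE (negPf ji) mulr0.
rewrite -expr2 mulrC; apply: le_trans (posdef_cauchy _ _ pM) _.
by rewrite mulmxKV // [dot e _]dotC.
Qed.

(** Inversion reverses the Loewner order: Cauchy-Schwarz for [M] at [x *m invmx M] and
    [x *m invmx N] gives [b ^+ 2 <= a * (c * b)], where [a] and [b] are the two inverse forms at
    [x]. *)
Lemma posdef_inv_le (R : realType) (n : nat) (M N : 'M[R]_n) (c : R) (x : 'rV[R]_n) :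
  posdef M -> posdef N -> (forall z, dot (z *m M) z <= c * dot (z *m N) z) ->
  dot (x *m invmx N) x <= c * dot (x *m invmx M) x.
Proof.
move=> pM pN MN; have uM := posdef_unit pM; have uN := posdef_unit pN.
have pM' := posdef_inv pM; have pN' := posdef_inv pN.
have [->|x0] := eqVneq x 0; first by rewrite !mul0mx dot0l mulr0.
have b0 : 0 < dot (x *m invmx N) x by case: pN' => _; exact.
have := posdef_cauchy (x *m invmx M) (x *m invmx N) pM.
rewrite mulmxKV // (dotC x (_ *m invmx M)) (dotC x (_ *m invmx N)).
have := MN (x *m invmx N); rewrite mulmxKV // (dotC x (_ *m invmx N)).
have := posdef_ge0 x pM'.
move: (dot (x *m invmx N) x) (dot (x *m invmx M) x) b0 => b a b0 a0 h1 h2.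
by rewrite -(ler_pM2r b0); nra.
Qed.

Lemma mxtrace_sqr_gt0 (R : realType) (n : nat) (M : 'M[R]_n) :
  (0 < n)%N -> posdef M -> 0 < \tr (M *m M).
Proof.
case: n M => // n M _ pM; have [sM _] := pM; have uM := posdef_unit pM.
have E i : dot (delta_mx 0 i *m (M *m M)) (delta_mx 0 i) =
    dot (delta_mx 0 i *m M) (delta_mx 0 i *m M).
  by rewrite mulmxA dot_mulmx sM.
rewrite mxtrace_dot (bigD1 ord0) //= E ltr_wpDr ?sumr_ge0 // => [i _|].
  by rewrite E dot_ge0.
rewrite dot_gt0 //; apply/negP => /eqP /(congr1 (mulmx^~ (invmx M))).
rewrite mulmxK // mul0mx => /rowP /(_ ord0); rewrite !mxE !eqxx => /eqP.
by rewrite oner_eq0.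
Qed.

(** The cost of moving the barrier. The trace bound keeps [M <= 2 N]; the resolvent identity
    [Y - X = d X Y] gives the growth of the trace, and [tr (Y Y) - tr (X Y) = d tr (Y X Y)] is
    nonnegative. *)
Lemma posdef_shift (R : realType) (n : nat) (M : 'M[R]_n) (d : R) :
  posdef M -> 0 <= d -> d * \tr (invmx M) <= 1 / 2 ->
  let N := M - d%:M in
  [/\ posdef N, \tr (invmx N) <= 2 * \tr (invmx M) &
    \tr (invmx N) - \tr (invmx M) <= d * \tr (invmx N *m invmx N)].
Proof.
move=> pM d0 dM N; have [sM pM0] := pM.
have qN z : dot (z *m N) z = dot (z *m M) z - d * dot z z.
  by rewrite mulmxBr mul_mx_scalar !dot_lin.
have MN z : dot (z *m M) z <= 2 * dot (z *m N) z.
  have := posdef_trace_inv_ge z pM; have := posdef_ge0 z pM; rewrite qN; nra.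
have pN : posdef N.
  split=> [|x x0]; first by rewrite linearB /= sM tr_scalar_mx.
  have := MN x; have := pM0 x x0; lra.
have uM := posdef_unit pM; have uN := posdef_unit pN.
have pX := posdef_inv pM; have pY := posdef_inv pN.
set X := invmx M in pX *; set Y := invmx N in pY *.
have YX : Y - X = d *: (X *m Y).
  have : X *m (M - N) *m Y = Y - X.
    by rewrite mulmxBr mulVmx // mulmxBl mul1mx -mulmxA mulmxV // mulmx1.
  by rewrite /N opprB addrC subrK mul_mx_scalar -scalemxAl => <-.
split=> //.
  rewrite !mxtrace_dot mulr_sumr; apply: ler_sum => i _.
  exact: posdef_inv_le.
rewrite -linearB YX linearZ ler_wpM2l // -subr_ge0 -linearB -mulmxBl YX -scalemxAl linearZ /=.
rewrite mulr_ge0 // mxtrace_mulC mxtrace_dot sumr_ge0 // => i _.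
have -> : delta_mx 0 i *m (Y *m (X *m Y)) = (delta_mx 0 i : 'rV_n) *m Y *m X *m Y.
  by rewrite !mulmxA.
by rewrite dot_mulmx (proj1 pY) posdef_ge0.
Qed.

(* Sherman-Morrison *)
Lemma posdef_rank1 (R : realType) (n : nat) (N : 'M[R]_n) (s : R) (u : 'rV[R]_n) :
  posdef N -> 0 <= s ->
  let Y := invmx N in
  posdef (N + s *: (u^T *m u)) /\
  \tr (invmx (N + s *: (u^T *m u))) =
    \tr Y - s * dot (u *m Y) (u *m Y) / (1 + s * dot (u *m Y) u).
Proof.
move=> pN s0 Y; have [sN pN0] := pN; have uN := posdef_unit pN.
have pY := posdef_inv pN; have b0 := posdef_ge0 u pY; have [sY _] := pY.
set N1 := N + _.
have p1 : posdef N1.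
  split=> [|x x0]; first by rewrite linearD linearZ /= trmx_mul trmxK sN.
  rewrite mulmxDr -scalemxAr dotDl dotZl dot_rank1 (dotC u).
  by rewrite ltr_wpDr ?pN0 // mulr_ge0 // -expr2 sqr_ge0.
split=> //; set c := 1 + s * dot (u *m Y) u.
have c0 : c != 0 by rewrite gt_eqF // ltr_wpDr // mulr_ge0.
pose X := Y - (s / c) *: ((u *m Y)^T *m (u *m Y)).
have uYu : u *m (u *m Y)^T = (dot (u *m Y) u)%:M.
  by rewrite [LHS]mx11_scalar dotC.
suff NX : N1 *m X = 1%:M.
  have -> : invmx N1 = X.
    by rewrite -[LHS]mulmx1 -NX mulmxA mulVmx ?mul1mx ?posdef_unit.
  by rewrite /X linearB linearZ /= mxtrace_rank1 mulrAC.
rewrite /N1 /X mulmxBr mulmxDl mulmxV // -!scalemxAr -!scalemxAl mulmxDl.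
have -> : N *m ((u *m Y)^T *m (u *m Y)) = u^T *m (u *m Y).
  by rewrite trmx_mul sY !mulmxA mulmxV // mul1mx.
have -> : s *: (u^T *m u) *m ((u *m Y)^T *m (u *m Y)) =
    (s * dot (u *m Y) u) *: (u^T *m (u *m Y)).
  rewrite -scalemxAl -mulmxA (mulmxA u) uYu mul_scalar_mx -scalemxAr scalerA.
  by congr (_ *: _).
rewrite -mulmxA -{2}[u^T *m _]scale1r -scalerDl scalerA -/c mulfVK //.
by rewrite addrK.
Qed.

(** * Barrier argument *)

(* The dual form of the existence of a John decomposition of the identity: a
   probability measure on [V] with barycentre 0 and covariance [1 / n] would
   provide, for each quadratic test function, a point where it is at least its
   average. *)
Definition isotropic_tests {R : realType} {n : nat} (V : set 'rV[R]_n) : Prop :=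
  forall (M : 'M[R]_n) (y : 'rV[R]_n) (e : R), M^T = M -> 0 < e ->
    exists2 v, V v & \tr M / n%:R - e < dot (v *m M) v + dot v y.

(* With [Y] the inverse of the shifted matrix, the weight [s = 1 / (1 + v Y v)]
   bounds the Sherman-Morrison gain below by [s v Y^2 v / 2]; multiplied by
   [1 + v Y v], the required decrease of the potential becomes quadratic in [v], so
   that a single test provides [v]. The shift [1 / (20 n)] is small enough for the
   average of this test to be positive as long as [tr Y <= 4 n]. *)
Lemma barrier_step (R : realType) (n : nat) (V : set 'rV[R]_n) (M : 'M[R]_n)
    (w : 'rV[R]_n) (h : R) :
  (0 < n)%N -> (forall v, V v -> dot v v <= 1) -> isotropic_tests V ->
  posdef M -> \tr (invmx M) <= 2 * n%:R -> 0 <= h ->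
  exists v s, [/\ V v, 0 <= s <= 1,
    posdef (M - (20 * n%:R)^-1%:M + s *: (v^T *m v)) &
    \tr (invmx (M - (20 * n%:R)^-1%:M + s *: (v^T *m v)))
      + h * dot (w + s *: v) (w + s *: v)
    <= \tr (invmx M) + h * dot w w + h].
Proof.
move=> n0 V1 VT pM trM h0; set d := (20 * n%:R)^-1.
have nR : 0 < n%:R :> R by rewrite ltr0n.
have d0 : 0 < d by rewrite invr_gt0 mulr_gt0.
have dn : d * n%:R = 20^-1 by rewrite /d; field; rewrite gt_eqF.
have dtr : d * \tr (invmx M) <= 1 / 2.
  apply: (@le_trans _ _ (d * (2 * n%:R))); first by rewrite ler_wpM2l // ltW.
  by rewrite mulrCA dn; lra.
case: (posdef_shift pM (ltW d0) dtr); set N := M - d%:M => pN trY trYX.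
have [sY _] := posdef_inv pN.
set Y := invmx N in sY trY trYX *; set D := \tr Y - \tr (invmx M) in trYX.
have YY0 : 0 < \tr (Y *m Y) by apply: mxtrace_sqr_gt0 => //; apply: posdef_inv.
pose K := (1 / 2) *: (Y *m Y) - D *: Y.
have sK : K^T = K by rewrite /K linearB !linearZ /= trmx_mul sY.
have trK : \tr K / n%:R = \tr (Y *m Y) / (2 * n%:R) - D * (\tr Y / n%:R).
  by rewrite /K linearB /= !mxtraceZ; field; rewrite gt_eqF.
have e0 : 0 < \tr K / n%:R - D.
  have tY4 : \tr Y / n%:R <= 4 by rewrite ler_pdivrMr //; lra.
  have tY0 : 0 <= \tr Y / n%:R.
    rewrite divr_ge0 ?(ltW nR) // mxtrace_dot sumr_ge0 // => i _.
    by apply: posdef_ge0; apply: posdef_inv.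
  (* The value of [d] turns [tr (Y Y) / (2 n)] into [10 d tr (Y Y)], while the subtracted term is at
     most [5 d tr (Y Y)]. *)
  have -> : \tr K / n%:R - D = 10 * (d * \tr (Y *m Y)) - D * (\tr Y / n%:R + 1).
    by rewrite trK /d; field; rewrite gt_eqF.
  have := mulr_gt0 d0 YY0; nra.
(* This choice of error puts the test value above [D]; the linear part provides for the cross term
   of [h |w + s v|^2]. *)
have [v Vv] := VT K (- (2 * h) *: w) _ sK e0.
rewrite opprB addrCA subrr addr0 => Hv.
have b0 : 0 <= dot (v *m Y) v by apply: posdef_ge0; apply: posdef_inv.
have a0 : 0 <= dot (v *m Y) (v *m Y) by exact: dot_ge0.
have KE : dot (v *m K) v + dot v (- (2 * h) *: w) =
    dot (v *m Y) (v *m Y) / 2 - D * dot (v *m Y) v - 2 * h * dot w v.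
  rewrite /K mulmxBr -!scalemxAr mulmxA !dot_lin (dot_mulmx _ (v *m Y)) sY.
  rewrite (dotC v w); lra.
rewrite KE in Hv.
pose s := (1 + dot (v *m Y) v)^-1.
have b1 : 0 < 1 + dot (v *m Y) v by rewrite ltr_wpDr.
have s0 : 0 < s by rewrite invr_gt0.
have sb : s + s * dot (v *m Y) v = 1 by rewrite -{1}[s]mulr1 -mulrDr mulVf // gt_eqF.
have sb0 : 0 <= s * dot (v *m Y) v by rewrite mulr_ge0 // ltW.
have s1 : s <= 1 by lra.
exists v, s; have [p1 ->] := posdef_rank1 v pN (ltW s0).
split=> //; first by rewrite (ltW s0).
rewrite -/Y !dot_lin (dotC v w).
have v1 := V1 _ Vv; have v0 := dot_ge0 v.
have lb : s * dot (v *m Y) (v *m Y) / 2 <=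
    s * dot (v *m Y) (v *m Y) / (1 + s * dot (v *m Y) v).
  rewrite ler_wpM2l ?mulr_ge0 ?(ltW s0) // lef_pV2 ?posrE //; lra.
have ss : h * (s * (s * dot v v)) <= h.
  rewrite -{2}[h]mulr1 ler_wpM2l //; nra.
have main : D <= s * dot (v *m Y) (v *m Y) / 2 - 2 * h * s * dot w v.
  have := ltW Hv; rewrite -subr_ge0 -(pmulr_rge0 _ s0) => ?.
  have -> : D = (s + s * dot (v *m Y) v) * D by rewrite sb mul1r.
  by lra.
rewrite /D in main; lra.
Qed.

Definition weighted_gram {R : realType} {n : nat} (l : seq (R * 'rV[R]_n)) : 'M[R]_n :=
  \sum_(p <- l) p.1 *: (p.2^T *m p.2).

Definition weighted_sum {R : realType} {n : nat} (l : seq (R * 'rV[R]_n)) : 'rV[R]_n :=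
  \sum_(p <- l) p.1 *: p.2.

(** The scalar part starts at 1 and falls by [1 / (20 n)] a step. With [h = 1 / 40] the potential
    stays below [2 n] during [40 n] steps, which preserves the trace bound required by
    [barrier_step]. *)
Lemma barrier_iter (R : realType) (n : nat) (V : set 'rV[R]_n) (k : nat) :
  (0 < n)%N -> (forall v, V v -> dot v v <= 1) -> isotropic_tests V ->
  (k <= 40 * n)%N ->
  exists l : seq (R * 'rV[R]_n), [/\ size l = k,
    forall p, p \in l -> V p.2 /\ 0 <= p.1 <= 1,
    posdef (weighted_gram l + (1 - k%:R / (20 * n%:R))%:M) &
    \tr (invmx (weighted_gram l + (1 - k%:R / (20 * n%:R))%:M))
      + 40^-1 * dot (weighted_sum l) (weighted_sum l) <= n%:R + k%:R / 40].
Proof.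
move=> n0 V1 VT; have nR : 0 < n%:R :> R by rewrite ltr0n.
elim: k => [|k IH] kn.
  exists [::]; rewrite /weighted_gram /weighted_sum !big_nil mul0r subr0 add0r.
  split=> //.
    by split=> [|x x0]; [rewrite tr_scalar_mx|rewrite mulmx1 dot_gt0].
  by rewrite invmx1 mxtrace1 dot0l mulr0 mul0r.
have [l [sl Vl pl tl]] := IH (ltnW kn).
have trl : \tr (invmx (weighted_gram l + (1 - k%:R / (20 * n%:R))%:M)) <= 2 * n%:R.
  have : (k%:R : R) <= 40 * n%:R by rewrite -natrM ler_nat ltnW.
  have := dot_ge0 (weighted_sum l); lra.
have h0 : 0 <= 40^-1 :> R by lra.
have [v [s [Vv s01]]] := barrier_step (weighted_sum l) n0 V1 VT pl trl h0.
set M := _ + s *: _; move=> p1 t1.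
have ME : weighted_gram ((s, v) :: l) + (1 - k.+1%:R / (20 * n%:R))%:M = M.
  rewrite /M /weighted_gram big_cons /= -addrA addrC; congr (_ + _).
  rewrite -addrA; congr (_ + _); rewrite -raddfB /=; congr (_%:M).
  by rewrite -[k.+1%:R]natr1 mulrDl mul1r opprD addrA.
exists ((s, v) :: l); rewrite ME; split=> //=; first by rewrite sl.
  by move=> p; rewrite inE => /predU1P[->//|/Vl].
have -> : weighted_sum ((s, v) :: l) = weighted_sum l + s *: v.
  by rewrite /weighted_sum big_cons addrC.
apply: (le_trans t1); rewrite -[k.+1%:R]natr1; lra.
Qed.

(** After [40 n] steps the scalar part is [-1], so the Gram matrix exceeds the identity; the trace
    being nonnegative, the bound [2 n] on the potential applies to [|w|^2 / 40]. *)
Lemma sparse_gram (R : realType) (n : nat) (V : set 'rV[R]_n) :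
  (0 < n)%N -> (forall v, V v -> dot v v <= 1) -> isotropic_tests V ->
  exists l : seq (R * 'rV[R]_n), [/\ size l = (40 * n)%N,
    forall p, p \in l -> V p.2 /\ 0 <= p.1 <= 1,
    forall x, dot x x <= \sum_(p <- l) p.1 * dot x p.2 ^+ 2 &
    dot (weighted_sum l) (weighted_sum l) <= 80 * n%:R].
Proof.
move=> n0 V1 VT; have nR : 0 < n%:R :> R by rewrite ltr0n.
have [l [sl Vl pl tl]] := barrier_iter n0 V1 VT (leqnn _).
have E : 1 - (40 * n)%:R / (20 * n%:R) = -1 :> R.
  by rewrite natrM; field; rewrite gt_eqF.
rewrite E in pl tl; exists l; split=> // [x|]; last first.
  have : 0 <= \tr (invmx (weighted_gram l + (-1)%:M)).
    rewrite mxtrace_dot sumr_ge0 // => i _.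
    by apply: posdef_ge0; apply: posdef_inv.
  by move: tl; rewrite natrM; lra.
have := posdef_ge0 x pl; rewrite mulmxDr mul_mx_scalar !dot_lin mulN1r subr_ge0.
move=> /le_trans; apply; rewrite mulmx_sumr dotC dot_sumr le_eqVlt; apply/orP; left.
apply/eqP; apply: eq_bigr => p _.
by rewrite -scalemxAr dotZr dotC dot_rank1 (dotC _ x) expr2.
Qed.

(** * Sparse approximation in the convex hull *)

(** With [t = dot y v], [r = |y|] and [a = r / (2 n)], the chosen test reads [(t - a) (t + r) > 0],
    and [t >= - r] by Cauchy-Schwarz. *)
Lemma far_direction (R : realType) (n : nat) (V : set 'rV[R]_n) (y : 'rV[R]_n) :
  (0 < n)%N -> (forall v, V v -> dot v v <= 1) -> isotropic_tests V -> y != 0 ->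
  exists2 v, V v & Num.sqrt (dot y y) / (2 * n%:R) <= dot y v.
Proof.
move=> n0 V1 VT y0; have nR : 0 < n%:R :> R by rewrite ltr0n.
have yy := dot_gt0 y0; set r := Num.sqrt _.
have r0 : 0 < r by rewrite sqrtr_gt0.
have rr : dot y y = r ^+ 2 by rewrite sqr_sqrtr // ltW.
set a := r / (2 * n%:R).
have a0 : 0 < a by rewrite divr_gt0 // mulr_gt0.
have sM : (y^T *m y)^T = y^T *m y by rewrite trmx_mul trmxK.
have [v Vv] := VT _ ((r - a) *: y) (a * r) sM (mulr_gt0 a0 r0).
rewrite mxtrace_rank1 rr dot_rank1 dotZr (dotC v y) => Hv; exists v => //.
have E : r ^+ 2 / n%:R - a * r = a * r by rewrite /a; field; rewrite gt_eqF.
rewrite E in Hv; rewrite leNgt; apply/negP => lt.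
have : (dot y v) ^+ 2 <= r ^+ 2.
  have := cauchy_schwarz y v; have := V1 _ Vv; rewrite -rr; have := dot_ge0 v; nra.
move=> tt; have : - r <= dot y v by rewrite leNgt; apply/negP; nra.
move=> ?; nra.
Qed.

(** A multiple of an affine dependence is subtracted from the coefficients, up to the first moment
    when one of them vanishes. *)
Lemma caratheodory_step (R : realType) (n : nat) (c : 'I_n.+2 -> R)
    (y : 'I_n.+2 -> 'rV[R]_n) :
  (forall i, 0 <= c i) ->
  exists c' : 'I_n.+1 -> R, exists f : 'I_n.+1 -> 'I_n.+2,
    [/\ forall j, 0 <= c' j, \sum_j c' j = \sum_i c i &
      \sum_j c' j *: y (f j) = \sum_i c i *: y i].
Proof.
move=> c0; pose A : 'M[R]_(n.+2, n + 1) := \matrix_i row_mx (y i) 1%:M.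
have : kermx A != 0.
  rewrite -mxrank_eq0 mxrank_ker -lt0n subn_gt0 (leq_ltn_trans (rank_leq_col _)) //.
  by rewrite addn1.
case/rowV0Pn => d /sub_kermxP dA d0.
have : \sum_i d 0 i *: row_mx (y i) 1%:M = 0 :> 'rV_(n + 1).
  rewrite -[RHS]dA mulmx_sum_row; by apply: eq_bigr => i _; rewrite rowK.
have -> : \sum_i d 0 i *: row_mx (y i) 1%:M =
    row_mx (\sum_i d 0 i *: y i) (\sum_i d 0 i)%:M :> 'rV_(n + 1).
  elim/big_ind3: _ => [|x1 x2 x3 z1 z2 z3 -> ->|i _].
  - by rewrite raddf0 row_mx0.
  - by rewrite add_row_mx raddfD.
  - by rewrite scale_row_mx scale_scalar_mx mulr1.
rewrite -row_mx0 => /eq_row_mx[dy /rowP/(_ ord0)]; rewrite !mxE mulr1n => d1.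
have [i1 i1P] : exists i, 0 < d 0 i.
  apply: contrapT => /forallNP dn; move/negP: d0; apply; apply/eqP/rowP => i.
  have dn' j : 0 <= - d 0 j by rewrite oppr_ge0 leNgt; apply/negP/dn.
  have : \sum_i - d 0 i == 0 by rewrite sumrN d1 oppr0.
  rewrite psumr_eq0 // => /allP /(_ i (mem_index_enum _)).
  by rewrite oppr_eq0 mxE => /eqP.
case: (@arg_minP _ _ _ i1 (fun i => 0 < d 0 i) (fun i => c i / d 0 i) i1P) => i0 i0P min.
set t := c i0 / d 0 i0.
pose e i := c i - t * d 0 i.
have t0 : 0 <= t by rewrite divr_ge0 // ltW.
have e0 i : 0 <= e i.
  rewrite subr_ge0; have [di|di] := ltP 0 (d 0 i).
    by rewrite -ler_pdivlMr // min.
  by apply: le_trans (c0 i); rewrite mulr_ge0_le0.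
have ei0 : e i0 = 0 by rewrite /e /t divfK ?subrr // gt_eqF.
exists (fun j => e (lift i0 j)), (lift i0); split=> //.
  transitivity (\sum_i e i); first by rewrite (bigD1_ord i0) //= ei0 add0r.
  by rewrite sumrB -mulr_sumr d1 mulr0 subr0.
transitivity (\sum_i e i *: y i).
  by rewrite [RHS](bigD1_ord i0) //= ei0 scale0r add0r.
under eq_bigr do rewrite scalerBl -scalerA.
by rewrite sumrB -scaler_sumr dy scaler0 subr0.
Qed.

Lemma dot_sub_le (R : realType) (n : nat) (x y : 'rV[R]_n) :
  dot (x - y) (x - y) <= 2 * dot x x + 2 * dot y y.
Proof. have := dot_ge0 (x + y); rewrite !dot_lin (dotC y x); lra. Qed.

Definition conv_comb {R : realType} {n m : nat} (V : set 'rV[R]_n)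
    (c : 'I_m -> R) (y : 'I_m -> 'rV[R]_n) : Prop :=
  [/\ forall i, V (y i), forall i, 0 <= c i & \sum_i c i = 1].

Lemma conv_comb_reduce (R : realType) (n : nat) (V : set 'rV[R]_n) (c : 'I_n.+2 -> R)
    (y : 'I_n.+2 -> 'rV[R]_n) : conv_comb V c y ->
  exists c' y', conv_comb V c' y' /\
    \sum_(j < n.+1) c' j *: y' j = \sum_i c i *: y i.
Proof.
move=> [Vy c0 c1]; have [c' [f [c'0 c'1 E]]] := caratheodory_step y c0.
by exists c', (y \o f); split=> //; split=> [i||] /=; rewrite ?c'1 //; exact: Vy.
Qed.

(* Frank-Wolfe step of length [|p - q|^2 / 4]. *)
Lemma conv_comb_step (R : realType) (n : nat) (V : set 'rV[R]_n) (q : 'rV[R]_n)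
    (c : 'I_n.+1 -> R) (y : 'I_n.+1 -> 'rV[R]_n) :
  (0 < n)%N -> (forall v, V v -> dot v v <= 1) -> isotropic_tests V ->
  dot q q <= (2 * n%:R) ^- 2 -> conv_comb V c y ->
  let r := \sum_j c j *: y j - q in dot r r <= 1 / 4 ->
  exists c' y', conv_comb V c' y' /\
    let r' := \sum_(j < n.+1) c' j *: y' j - q in
    dot r' r' <= dot r r - dot r r ^+ 2 / 4.
Proof.
move=> n0 V1 VT qn cc; set p := \sum_j c j *: y j.
have pE : \sum_j c j *: y j = p by []; clearbody p.
move=> r; have rE : p - q = r by []; clearbody r => r14.
have nR : 0 < n%:R :> R by rewrite ltr0n.
have [r0|r0] := eqVneq r 0.
  by exists c, y; split=> //=; rewrite pE rE r0 dot0l expr0n mul0r subr0.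
have [v Vv] : exists2 v, V v &
    Num.sqrt (dot (- r) (- r)) / (2 * n%:R) <= dot (- r) v.
  by apply: far_direction; rewrite // oppr_eq0.
rewrite !dot_lin opprK.
have rr := dot_gt0 r0; set s := Num.sqrt _; set k := 2 * n%:R in qn * => Hv.
have k2 : 2 <= k by rewrite /k -[leLHS]mulr1 ler_pM2l // ler1n.
have k0 : 0 < k by apply: lt_le_trans k2.
have s0 : 0 < s by rewrite sqrtr_gt0.
have ss : dot r r = s ^+ 2 by rewrite sqr_sqrtr // ltW.
(* The radius [1 / (2 n)] allowed for [q] matches the gain of [far_direction], whence
   [dot r (v - q) <= 0]. *)
have rq : - dot r q <= s / k.
  have : dot r q ^+ 2 <= (s / k) ^+ 2.
    apply: le_trans (cauchy_schwarz _ _) _.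
    by rewrite expr_div_n -ss ler_wpM2l // ltW.
  have : 0 < s / k by rewrite divr_gt0.
  by move=> ? ?; rewrite leNgt; apply/negP; nra.
have q4 : dot q q <= 1 / 4.
  apply: le_trans qn _; rewrite div1r lef_pV2 ?posrE ?exprn_gt0 //; nra.
have p1 : dot p p <= 1.
  have := dot_sub_le r (- q); rewrite opprK -rE subrK rE !dot_lin opprK; lra.
have vp4 : dot (v - p) (v - p) <= 4.
  have := dot_sub_le v p; have := V1 _ Vv; lra.
have rvp : dot r (v - p) <= - dot r r.
  by have -> : v - p = v - q - r; rewrite ?dot_lin; [rewrite -rE opprB addrA subrK|lra].
pose t := dot r r / 4.
have t0 : 0 <= t by rewrite divr_ge0 // ltW.
have t1 : 0 <= 1 - t by rewrite /t; lra.
case: cc => Vy c0 c1.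
pose c2 i := if unlift ord0 i is Some j then (1 - t) * c j else t.
pose y2 i := if unlift ord0 i is Some j then y j else v.
have cc2 : conv_comb V c2 y2.
  split=> [i|i|]; rewrite /c2 /y2; [by case: unlift| |].
    by case: unlift => // j; rewrite mulr_ge0.
  rewrite big_ord_recl unlift_none; under eq_bigr do rewrite liftK.
  by rewrite -mulr_sumr c1 mulr1 addrC subrK.
have [c' [y' [cc' E]]] := conv_comb_reduce cc2.
exists c', y'; split=> //=; rewrite E /c2 /y2 big_ord_recl unlift_none.
under eq_bigr do rewrite liftK -scalerA.
rewrite -scaler_sumr pE.
have -> : t *: v + (1 - t) *: p - q = r + t *: (v - p).
  by rewrite -rE; apply/rowP => j; rewrite !mxE; ring.
move: (v - p) vp4 rvp => z vp4 rvp.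
have -> : dot (r + t *: z) (r + t *: z) =
    dot r r + t * (2 * dot r z + t * dot z z).
  by rewrite !dot_lin (dotC z r); ring.
(* As [|z|^2 <= 4], the second-order term consumes at most half of the first-order gain. *)
have : 2 * dot r z + t * dot z z <= - dot r r.
  have := dot_ge0 z; rewrite /t; nra.
by move=> /(ler_wpM2l t0); rewrite {3}/t; lra.
Qed.

(** Starting at the point 0 of [V], each step gains at least [e ^+ 2 / 4] while the error exceeds
    [e]. The number of steps may be arbitrary, since each one returns to [n + 1] points. *)
Lemma conv_comb_approx (R : realType) (n : nat) (V : set 'rV[R]_n) (q : 'rV[R]_n) (e : R) :
  (0 < n)%N -> (forall v, V v -> dot v v <= 1) -> isotropic_tests V -> V 0 ->
  dot q q <= (2 * n%:R) ^- 2 -> 0 < e ->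
  exists c y, conv_comb V c y /\
    let r := \sum_(j < n.+1) c j *: y j - q in dot r r <= e.
Proof.
move=> n0 V1 VT V0 qn e0; have nR : 0 < n%:R :> R by rewrite ltr0n.
have main N : exists c y, conv_comb V c y /\
    let r := \sum_(j < n.+1) c j *: y j - q in
    dot r r <= 1 / 4 /\ (dot r r <= e \/ dot r r <= 1 / 4 - N%:R * (e ^+ 2 / 4)).
  elim: N => [|N [c [y [cc /= [r14 rN]]]]].
    exists (fun j => (j == ord0)%:R), (fun=> 0); split.
      split=> [//|i|]; first by rewrite ler0n.
      by rewrite (bigD1 ord0) //= big1 ?addr0 // => i /negPf ->.
    rewrite /= big1 => [|i _]; last by rewrite scaler0.
    rewrite sub0r !dot_lin opprK mul0r subr0.
    suff q4 : dot q q <= 1 / 4 by split; [|right].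
    apply: le_trans qn _; have : 1 <= n%:R :> R by rewrite ler1n.
    by move=> ?; rewrite div1r lef_pV2 ?posrE ?exprn_gt0 ?mulr_gt0 //; nra.
  have [c' [y' [cc' /=]]] := conv_comb_step n0 V1 VT qn cc r14.
  set r := dot (\sum_j c j *: _ - _) _ in r14 rN *; set r' := dot _ _ => rr'.
  exists c', y'; split=> //=; rewrite -/r'.
  have r2 := sqr_ge0 r.
  split; first by lra.
  have [re|er] := leP r e; first by left; lra.
  right; case: rN => [|rN]; first by rewrite leNgt er.
  have : e ^+ 2 <= r ^+ 2 by rewrite ler_sqr ?nnegrE ?ltW // (lt_trans e0).
  rewrite -[N.+1%:R]natr1; lra.
have e2 : 0 < e ^+ 2 / 4 by rewrite divr_gt0 // exprn_gt0.
have [N HN] : exists N : nat, 1 / 4 / (e ^+ 2 / 4) < N%:R.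
  exists (Num.bound (1 / 4 / (e ^+ 2 / 4))); apply: archi_boundP.
  by rewrite divr_ge0 // ltW.
have [c [y [cc /= [_ [re|re]]]]] := main N; first by exists c, y.
exfalso; move: re; apply/negP; rewrite -ltNge.
by rewrite (lt_le_trans _ (dot_ge0 _)) // subr_lt0 -ltr_pdivrMr.
Qed.

(** Here [t ^+ 2 <= r |t|], and [|t| <= 2 - t] since [t <= 1]. Linear terms replace squares so that
    the weighted sum can appear. *)
Lemma sqr_le_of_le1 (R : realType) (r t : R) :
  0 <= r -> t ^+ 2 <= r ^+ 2 -> t <= 1 -> t ^+ 2 <= r * (2 - t).
Proof.
move=> r0 tr t1; have [t0|t0] := lerP 0 t; last first.
  have : - t <= r by nra.
  by move=> ?; nra.
have : t <= r by nra.
by move=> ?; nra.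
Qed.

Lemma sparse_polar (R : realType) (n : nat) (V : set 'rV[R]_n) :
  (0 < n)%N -> (forall v, V v -> dot v v <= 1) -> isotropic_tests V -> V 0 ->
  exists l : seq 'rV[R]_n, [/\ size l = (40 * n + n.+1)%N,
    forall v, v \in l -> V v &
    forall x, (forall v, v \in l -> dot x v <= 1) ->
      dot x x <= (200 * (n%:R * Num.sqrt n%:R)) ^+ 2].
Proof.
move=> n0 V1 VT V0; have nR : 1 <= n%:R :> R by rewrite ler1n.
have n0R : 0 < n%:R :> R by rewrite ltr0n.
set N : R := n%:R in nR n0R *; set S := Num.sqrt N.
have SS : S ^+ 2 = N by rewrite sqr_sqrtr // ltW.
have S1 : 1 <= S by rewrite -[1]sqrtr1 ler_sqrt.
have [l [sl Vl ge w80]] := sparse_gram n0 V1 VT.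
set w := weighted_sum l in w80.
(* As [80 <= 81], [9 * S] bounds [|w|], so that [q] has length at most [1 / (2 n)]. *)
pose W := 2 * N * (9 * S).
have W0 : 0 < W by rewrite /W; nra.
pose q := - W^-1 *: w.
have q1 : dot q q <= (2 * N) ^- 2.
  have -> : dot q q = W ^- 2 * dot w w by rewrite /q !dot_lin -exprVn; ring.
  have -> : (2 * N) ^- 2 = W ^- 2 * (81 * N).
    by rewrite /W -SS; field; rewrite gt_eqF // (lt_le_trans _ S1).
  by rewrite ler_wpM2l ?invr_ge0 ?exprn_ge0 ?(ltW W0) //; lra.
have e0 : 0 < (2 * W) ^- 2 by rewrite invr_gt0 exprn_gt0 // mulr_gt0.
have [c [y [[Vy c0 c1] /=]]] := conv_comb_approx n0 V1 VT V0 q1 e0.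
set p := \sum_j _ => pq.
exists (map snd l ++ map y (enum 'I_n.+1)); split.
- by rewrite size_cat !size_map sl -enumT size_enum_ord.
- move=> v; rewrite mem_cat => /orP[|] /mapP[z]; last by move=> _ ->.
  by move=> /Vl[? _] ->.
move=> x xl.
have xl1 z : z \in l -> dot x z.2 <= 1.
  by move=> zl; apply: xl; rewrite mem_cat map_f.
have xy j : dot x (y j) <= 1.
  by apply: xl; rewrite mem_cat map_f ?orbT // mem_enum.
set r := Num.sqrt (dot x x).
have r0 : 0 <= r by rewrite sqrtr_ge0.
have rr : dot x x = r ^+ 2 by rewrite sqr_sqrtr // dot_ge0.
suff : r <= 200 * (N * S) by move=> H; rewrite rr ler_sqr ?nnegrE //; nra.
have [->|rn0] := eqVneq r 0; first by nra.
have rp : 0 < r by rewrite lt_neqAle eq_sym rn0.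
have r80 : r <= 80 * N - dot x w.
  rewrite -(ler_pM2l rp) -expr2 -rr; apply: le_trans (ge x) _.
  have s40 : \sum_(z <- l) z.1 <= 40 * N.
    rewrite -natrM -sl -sum1_size natr_sum big_seq [leRHS]big_seq.
    by apply: ler_sum => z /Vl[_ /andP[]].
  apply: (@le_trans _ _ (\sum_(z <- l) r * (2 * z.1 - dot x (z.1 *: z.2)))).
    rewrite big_seq [leRHS]big_seq; apply: ler_sum => z zl.
    have [Vz /andP[z0 _]] := Vl _ zl.
    rewrite dotZr [2 * _]mulrC -mulrBr [leRHS]mulrCA ler_wpM2l // sqr_le_of_le1 ?xl1 //.
    apply: le_trans (cauchy_schwarz _ _) _.
    by rewrite -rr ler_piMr ?dot_ge0 // V1.
  rewrite -mulr_sumr sumrB -dot_sumr -mulr_sumr ler_pM2l // lerD2r; lra.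
have xp : dot x p <= 1.
  rewrite dot_sumr -c1; apply: ler_sum => j _.
  by rewrite dotZr ler_piMr.
have xpq : - dot x (p - q) <= r / (2 * W).
  have : dot x (p - q) ^+ 2 <= (r / (2 * W)) ^+ 2.
    apply: le_trans (cauchy_schwarz _ _) _.
    by rewrite expr_div_n rr ler_wpM2l // exprn_ge0.
  have : 0 <= r / (2 * W) by rewrite divr_ge0 // mulr_ge0 // ltW.
  by move=> ? ?; rewrite leNgt; apply/negP; nra.
have xw : - dot x w = W * (dot x p - dot x (p - q)).
  by rewrite /q !dot_lin; field; rewrite gt_eqF.
have : W * (dot x p - dot x (p - q)) <= W + r / 2.
  have -> : W + r / 2 = W * (1 + r / (2 * W)) by field; rewrite gt_eqF.
  by rewrite ler_pM2l // lerD.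
(* Altogether [r <= 80 N + W + r / 2] with [W = 18 N S], so [r <= 196 N S]; the accuracy [1 / (2 W)]
   was chosen to leave only [r / 2] on the right. *)
rewrite -xw => ?; have : N <= N * S by rewrite ler_peMr // ltW.
by have : W = 18 * (N * S); [rewrite /W; ring|lra].
Qed.

(** * Ellipsoids of maximal volume *)

Lemma horner_char_poly (R : comNzRingType) (n : nat) (A : 'M[R]_n) (s : R) :
  (char_poly A).[s] = \det (s%:M - A).
Proof.
rewrite -[LHS]/(horner_eval s _) -det_map_mx; congr (\det _); apply/matrixP => i j.
by rewrite !mxE -[LHS]/(('X *+ (i == j) - (A i j)%:P).[s])
  hornerD hornerN hornerC hornerMn hornerX.
Qed.

(* The expansion of the characteristic polynomial of [- H] at [1 / t]. *)
Lemma det_perturb_gt1 (R : realType) (n : nat) (H : 'M[R]_n) :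
  0 < \tr H -> exists2 t0, 0 < t0 & forall t, 0 < t <= t0 -> 1 < \det (1%:M + t *: H).
Proof.
case: n H => [|n] H; first by rewrite /mxtrace big_ord0 ltxx.
move=> trH; set p := char_poly (- H).
have pn : p`_n = \tr H by rewrite (char_poly_trace (- H) (ltn0Sn n)) raddfN opprK.
have pn1 : p`_n.+1 = 1.
  by have /monicP := char_poly_monic (- H); rewrite lead_coefE size_char_poly.
pose C := \sum_(i < n) `|p`_i|.
have C0 : 0 <= C by apply: sumr_ge0.
pose S := 1 + C / \tr H.
have S0 : 0 < S by rewrite ltr_pwDl // divr_ge0 // ltW.
exists S^-1; rewrite ?invr_gt0 // => t /andP[t0 tS]; set s := t^-1.
have Ss : S <= s by rewrite -[S]invrK lef_pV2 ?posrE ?invr_gt0.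
have s1 : 1 <= s by apply: le_trans Ss; rewrite lerDl divr_ge0 // ltW.
have s0 : 0 < s by apply: lt_le_trans s1.
have -> : 1%:M + t *: H = t *: (s%:M - - H).
  by rewrite opprK scalerDr scale_scalar_mx mulfV ?gt_eqF.
(* Multiplied by [s ^+ n.+1], the claim says that [\tr H * s ^+ n] outweighs the lower terms of [p],
   of total at most [C * s ^+ n / s]; [S] ensures [C < \tr H * s]. *)
rewrite detZ -horner_char_poly -/p -(ltr_pM2l (exprn_gt0 n.+1 s0)) mulr1 mulrA.
rewrite -exprMn mulVf ?gt_eqF // expr1n mul1r.
rewrite horner_coef size_char_poly !big_ord_recr /= pn pn1 mul1r -subr_gt0 addrK.
have lb : - (C * s ^+ n) <= (\sum_(i < n) p`_i * s ^+ i) * s.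
  rewrite lerNl -mulNr -sumrN mulr_suml /C mulr_suml; apply: ler_sum => i _.
  rewrite -mulNr -mulrA -exprSr; apply: (@le_trans _ _ (`|p`_i| * s ^+ i.+1)).
    by rewrite -normrN ler_wpM2r ?ler_norm // exprn_ge0 // ltW.
  by rewrite ler_wpM2l // ler_weXn2l.
rewrite -(pmulr_lgt0 _ s0) mulrDl.
have sn := exprn_gt0 n s0.
have : C < \tr H * s.
  rewrite mulrC -ltr_pdivrMr //; apply: lt_le_trans Ss; rewrite /S; lra.
by rewrite -(ltr_pM2r sn); lra.
Qed.

(** The constant is the squared Frobenius norm of [H]. *)
Lemma dot_mulmx_bounded (R : realType) (n : nat) (H : 'M[R]_n) :
  exists2 C, 0 <= C & forall v : 'rV[R]_n, dot (v *m H) (v *m H) <= C * dot v v.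
Proof.
exists (\sum_j dot (col j H)^T (col j H)^T).
  by apply: sumr_ge0 => j _; apply: dot_ge0.
move=> v; rewrite dotE mulr_suml; apply: ler_sum => j _.
have -> : (v *m H) 0 j = dot v (col j H)^T.
  by rewrite dotE mxE; apply: eq_bigr => i _; rewrite !mxE.
by rewrite -expr2 mulrC; apply: cauchy_schwarz.
Qed.

(** * Polars relative to an inscribed ellipsoid *)

Definition point_separable {R : realType} {n : nat} (C : set 'rV[R]_n) : Prop :=
  forall x, ~ C x -> exists a b, (forall y, C y -> dot a y <= b) /\ b < dot a x.

(** An ellipsoid is given as an affine image of the Euclidean unit ball; a positive [\det L] is
    proportional to its volume. *)
Definition inscribed {R : realType} {n : nat} (C : set 'rV[R]_n) (z : 'rV[R]_n)
    (L : 'M[R]_n) : Prop :=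
  forall u, dot u u <= 1 -> C (z + u *m L).

(** The polars are taken in the coordinates where the ellipsoid is the unit ball. In their union,
    unlike in the polar of the intersection, each point comes from a single index. *)
Definition polar_normals {R : realType} {n : nat} {I : Type} (P : I -> set 'rV[R]_n)
    (z : 'rV[R]_n) (L : 'M[R]_n) : set 'rV[R]_n :=
  [set v | exists i, forall u, P i (z + u *m L) -> dot v u <= 1].

Lemma polar_normals_le1 (R : realType) (n : nat) (I : Type) (P : I -> set 'rV[R]_n)
    (z : 'rV[R]_n) (L : 'M[R]_n) (v : 'rV[R]_n) :
  (forall i, inscribed (P i) z L) -> polar_normals P z L v -> dot v v <= 1.
Proof.
move=> ins [i Hi]; have [->|v0] := eqVneq v 0; first by rewrite dot0l.
have vv := dot_gt0 v0; set r := Num.sqrt (dot v v).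
have r0 : 0 < r by rewrite sqrtr_gt0.
have rr : dot v v = r ^+ 2 by rewrite sqr_sqrtr // ltW.
have : dot v (r^-1 *: v) <= 1.
  apply/Hi/ins; rewrite !dot_lin rr.
  by have -> : r^-1 * (r^-1 * r ^+ 2) = 1 by field; rewrite gt_eqF.
rewrite dotZr rr; have -> : r^-1 * r ^+ 2 = r by field; rewrite gt_eqF.
by move=> r1; rewrite expr_le1 // ltW.
Qed.

(** One half of the bipolar theorem: a hyperplane separating the point from [P i], once normalised,
    would be a polar point violating the hypothesis. *)
Lemma inscribed_of_polar (R : realType) (n : nat) (I : Type) (P : I -> set 'rV[R]_n)
    (z : 'rV[R]_n) (L : 'M[R]_n) (u : 'rV[R]_n) :
  (forall i, point_separable (P i)) -> (forall i, inscribed (P i) z L) ->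
  (forall v, polar_normals P z L v -> dot v u <= 1) -> forall i, P i (z + u *m L).
Proof.
move=> sep ins H i; apply: contrapT => /sep[a [b [ab bu]]].
pose w := a *m L^T; pose c := b - dot a z.
have aE y : dot a (z + y *m L) = dot a z + dot w y.
  by rewrite dotDr /w dot_mulmx trmxK.
have wc y : P i (z + y *m L) -> dot w y <= c.
  by move/ab; rewrite aE /c; lra.
have cu : c < dot w u by move: bu; rewrite aE /c; lra.
have c0 : 0 <= c by rewrite -(dot0r w); apply/wc/ins; rewrite dot0l.
have w0 : w != 0.
  by apply: contraTneq cu => ->; rewrite dot0l -leNgt.
have ww := dot_gt0 w0.
(* The normalisation divides by [c]; positivity is read off at a multiple of [w] short enough for
   the unit ball. *)
have cp : 0 < c.
  have := wc ((1 / (1 + dot w w)) *: w).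
  rewrite dotZr => Hc; apply: lt_le_trans (Hc _).
    by rewrite mulr_gt0 // divr_gt0 //; lra.
  apply: ins; rewrite !dot_lin div1r mulrA -expr2 exprVn mulrC.
  rewrite ler_pdivrMr ?exprn_gt0 //; nra.
have : dot (c^-1 *: w) u <= 1.
  apply: H; exists i => y /wc; rewrite dotZl => ?.
  by rewrite mulrC ler_pdivrMr // mul1r.
by rewrite dotZl mulrC ler_pdivrMr // mul1r leNgt cu.
Qed.

(* A perturbation [u |-> t y + u (1 + t H)] of the maximal ellipsoid would remain
   inscribed and have a larger volume. *)
Lemma max_ellipsoid_isotropic (R : realType) (n : nat) (I : Type)
    (P : I -> set 'rV[R]_n) (z : 'rV[R]_n) (L : 'M[R]_n) :
  (0 < n)%N -> (forall i, point_separable (P i)) -> (forall i, inscribed (P i) z L) ->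
  0 < \det L ->
  (forall z' L', (forall i, inscribed (P i) z' L') -> \det L' <= \det L) ->
  isotropic_tests (polar_normals P z L).
Proof.
move=> n0 sep ins dL maxL M y e sM e0; apply: contrapT => noV.
have nR : 0 < n%:R :> R by rewrite ltr0n.
set T := \tr M / n%:R.
have {}noV v : polar_normals P z L v -> dot (v *m M) v + dot v y <= T - e.
  by move=> Vv; rewrite leNgt; apply/negP => ?; apply: noV; exists v.
(* Half of the slack [e] makes [\tr H] positive, so that the determinant grows; the other half pays
   for the terms of order [t ^+ 2]. *)
pose H := M - (T - e / 2)%:M.
have sH : H^T = H by rewrite /H linearB /= sM tr_scalar_mx.
have trH : 0 < \tr H.
  rewrite /H linearB /= mxtrace_scalar -[_ *+ n]mulr_natr.
  have -> : \tr M = T * n%:R by rewrite divfK // gt_eqF.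
  by rewrite -mulrBl mulr_gt0 //; lra.
have [t0 t0p dt] := det_perturb_gt1 trH.
have [C C0 HC] := dot_mulmx_bounded H.
(* The three summands enforce [t <= t0], [t * T <= 1 / 2] and [t * C <= e]. *)
pose t := (t0^-1 + 2 * `|T| + C / e)^-1.
have t0i : 0 < t0^-1 by rewrite invr_gt0.
have Ce : 0 <= C / e by rewrite divr_ge0 // ltW.
have T0 := normr_ge0 T.
have ti : 0 < t0^-1 + 2 * `|T| + C / e by lra.
have tp : 0 < t by rewrite invr_gt0.
have tS : t * (t0^-1 + 2 * `|T| + C / e) = 1 by rewrite mulVf // gt_eqF.
have tt0 : t <= t0 by rewrite -[t0]invrK lef_pV2 ?posrE //; lra.
have tT : t * T <= 1 / 2.
  have := ler_norm T; have : 0 <= t * t0^-1 by rewrite mulr_ge0 // ltW.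
  have : 0 <= t * (C / e) by rewrite mulr_ge0 // ltW.
  nra.
have tC : t * C <= e.
  have : t * (C / e) <= 1.
    have : 0 <= t * t0^-1 by rewrite mulr_ge0 // ltW.
    have : 0 <= t * `|T| by rewrite mulr_ge0 // ltW.
    lra.
  by rewrite mulrA ler_pdivrMr // mul1r.
have /maxL : forall i, inscribed (P i) (z + (t *: y) *m L) ((1%:M + t *: H) *m L).
  move=> i u u1.
  have -> : z + t *: y *m L + u *m ((1%:M + t *: H) *m L) =
      z + (t *: y + u + t *: (u *m H)) *m L.
    by rewrite mulmxA mulmxDr mulmx1 -scalemxAr -addrA -mulmxDl addrA.
  apply: inscribed_of_polar => // v Vv.
  have v1 := polar_normals_le1 ins Vv; have v0 := dot_ge0 v.
  have := noV v Vv.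
  have -> : dot (v *m M) v = dot (v *m H) v + (T - e / 2) * dot v v.
    by rewrite /H mulmxBr mul_mx_scalar !dot_lin subrK.
  rewrite !dot_lin => Hv.
  (* This expands [|v + t v H - u|^2 >= 0], with [|u| <= 1]. *)
  have uv : dot v u + t * dot v (u *m H) <=
      1 / 2 + dot v v / 2 + t * dot (v *m H) v + t ^+ 2 * (C * dot v v) / 2.
    have := dot_ge0 (v + t *: (v *m H) - u).
    rewrite !dot_lin (dotC u (v *m H)) (dotC u v) (dotC v (v *m H)) (dot_mulmx H v u) sH.
    have := ler_wpM2l (sqr_ge0 t) (HC v); nra.
  have h1 : t * (dot (v *m H) v + dot v y) <= t * ((T - e / 2) * (1 - dot v v) - e / 2).
    by rewrite ler_pM2l //; lra.
  have h2 : t ^+ 2 * (C * dot v v) <= t * e.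
    rewrite expr2 -mulrA ler_pM2l // mulrA -[leRHS]mulr1 ler_pM //.
    by rewrite mulr_ge0 // ltW.
  have h3 : t * (T - e / 2) * (1 - dot v v) <= 1 / 2 * (1 - dot v v).
    rewrite ler_wpM2r ?subr_ge0 //.
    have : 0 <= t * e by rewrite mulr_ge0 ?ltW.
    lra.
  lra.
rewrite det_mulmx ger_pMl // leNgt dt //; apply/andP; split=> //.
Qed.

(** * Separation by nearest points and existence of the maximal ellipsoid *)

Lemma continuous_sum (R : realType) (T : topologicalType) (I : Type) (r : seq I)
    (f : I -> T -> R) :
  (forall i, continuous (f i)) -> continuous (fun x => \sum_(i <- r) f i x).
Proof.
by move=> cf; apply: continuous_big => // x; apply: cvgD; [apply: cvg_fst|apply: cvg_snd].
Qed.

Lemma continuous_prod (R : realType) (T : topologicalType) (I : Type) (r : seq I)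
    (f : I -> T -> R) :
  (forall i, continuous (f i)) -> continuous (fun x => \prod_(i <- r) f i x).
Proof.
by move=> cf; apply: continuous_big => // x; apply: cvgM; [apply: cvg_fst|apply: cvg_snd].
Qed.

Lemma continuous_rV (R : realType) (T : topologicalType) (n : nat) (f : T -> 'rV[R]_n) :
  (forall j, continuous (fun x => f x 0 j)) -> continuous f.
Proof.
move=> cf x A [P nP sPA].
have : \forall y \near x, forall j, P 0 j (f y 0 j).
  by apply: filter_forall => j; apply: cf; apply: nP.
apply: filterS => y Py; apply: sPA => i j; rewrite ord1; exact: Py.
Qed.

Lemma dot_subZ (R : realType) (n : nat) (a d : 'rV[R]_n) (t : R) :
  dot (a - t *: d) (a - t *: d) = dot a a - 2 * t * dot a d + t ^+ 2 * dot d d.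
Proof. by rewrite !dot_lin (dotC d a); ring. Qed.

(** The hyperplane is orthogonal to the segment from [x] to its nearest point [y0]; a point of [C]
    beyond it would allow a move from [y0] that shortens the distance. *)
Lemma compact_convex_point_separable (R : realType) (n : nat) (C : set 'rV[R]_n) :
  convex_set C -> compact C -> C !=set0 -> point_separable C.
Proof.
move=> cvC cC C0 x Cx.
have cf : continuous (fun y : 'rV[R]_n => dot (x - y) (x - y)).
  under eq_fun do rewrite dotE; apply: continuous_sum => j.
  have -> : (fun y : 'rV[R]_n => (x - y) 0 j * (x - y) 0 j) =
      (fun y => (x 0 j - y 0 j) * (x 0 j - y 0 j)).
    by apply/funext => y; rewrite !mxE.
  have h : continuous (fun y : 'rV[R]_n => x 0 j - y 0 j).
    by move=> y; apply: continuousB; [exact: cst_continuous|exact: coord_continuous].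
  by move=> y; exact: (continuousM (h y) (h y)).
have [y0 /set_mem Cy0 min] := EVT_min_rV C0 cC (continuous_subspaceT cf).
pose a := x - y0.
have a0 : a != 0 by rewrite subr_eq0; apply: contra_not_neq Cx => ->.
have aa := dot_gt0 a0.
exists a, (dot a y0); split; last by rewrite -subr_gt0 -dotNr -dotDr.
move=> y Cy; rewrite -subr_le0 -dotNr -dotDr; set d := y - y0.
rewrite leNgt; apply/negP => ad.
(* The enlarged denominator keeps [t <= 1], and [t] remains short enough for the distance to
   decrease. *)
pose t := dot a d / (dot a d + dot d d).
have dd := dot_ge0 d.
have S0 : 0 < dot a d + dot d d by rewrite ltr_wpDr.
have t0 : 0 < t by rewrite divr_gt0.
have t1 : t <= 1 by rewrite ler_pdivrMr // mul1r lerDl.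
have := cvC y y0 (Itv01 (ltW t0) t1); rewrite !inE => /(_ Cy Cy0).
set y1 := conv _ _ _ => Cy1.
have {min} := min y1 (mem_set Cy1).
have -> : x - y1 = a - t *: d.
  have -> : y1 = t *: y + (1 - t) *: y0 by [].
  by apply/rowP => j; rewrite !mxE; ring.
rewrite dot_subZ -/a.
have : t * (dot a d + dot d d) = dot a d by rewrite divfK // gt_eqF.
nra.
Qed.

Lemma coord_le_norm (R : realType) (n : nat) (y : 'rV[R]_n) (j : 'I_n) :
  `|y 0 j| <= `|y|.
Proof.
by rewrite [leRHS]/Num.norm /= mx_normrE; apply/bigmax_geP; right => /=; exists (0, j).
Qed.

(** The determinant attains its maximum on the compact set of inscribed pairs, encoded as rows of
    length [n + n * n]. A small ball inside [C] shows that the maximum is positive. *)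
Lemma exists_max_ellipsoid (R : realType) (n : nat) (C : set 'rV[R]_n) :
  compact C -> C° !=set0 ->
  exists z L, [/\ inscribed C z L, 0 < \det L &
    forall z' L', inscribed C z' L' -> \det L' <= \det L].
Proof.
move=> cC [x0 /nbhs_ballP[e /= e0 x0C]].
pose zz (N : 'rV[R]_(n + n * n)) : 'rV[R]_n := lsubmx N.
pose LL (N : 'rV[R]_(n + n * n)) : 'M[R]_n := vec_mx (rsubmx N).
pose F := [set N | inscribed C (zz N) (LL N)].
have cLL i j : continuous (fun N => LL N i j).
  have -> : (fun N => LL N i j) = (fun N => N 0 (rshift n (mxvec_index i j))).
    by apply/funext => N; rewrite !mxE.
  exact: coord_continuous.
have FE : F = \bigcap_(u in [set u : 'rV[R]_n | dot u u <= 1])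
    (fun N => zz N + u *m LL N) @^-1` C.
  by [].
have clF : closed F.
  rewrite FE; apply: closed_bigI => u _; apply: closed_comp.
    move=> N _; apply: continuous_rV => j {N}.
    have -> : (fun N => (zz N + u *m LL N) 0 j) =
        (fun N => N 0 (lshift (n * n) j) + \sum_i u 0 i * LL N i j).
      by apply/funext => N; rewrite !mxE.
    move=> N; apply: continuousD; first exact: coord_continuous.
    apply: continuous_sum => i {}N; apply: continuousM; first exact: cst_continuous.
    exact: cLL.
  exact: compact_closed (@norm_hausdorff _ _) cC.
have [M _ CM] : exists2 M, 0 < M & forall y, C y -> `|y| <= M.
  have /ex_strict_bound_gt0[M M0 HM] := compact_bounded cC.
  by exists M => // y /HM /ltW.
have d1 i : dot (delta_mx 0 i) (delta_mx 0 i) = 1 :> R.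
  by rewrite -{1}[delta_mx _ _]mulmx1 dot_delta mxE eqxx.
have cF : compact F.
  (* The centre lies in [C], and each row of [L] is a difference of two points of [C], hence the box
     of half-width [2 * M]. *)
  apply: subclosed_compact clF (@rV_compact _ _ (fun=> `[- (2 * M), 2 * M]%classic) _) _.
    by move=> _; apply: segment_compact.
  move=> N FN k; rewrite /= in_itv /= -ler_norml.
  have Fz : C (zz N) by have := FN 0; rewrite dot0l mul0mx addr0; apply.
  have zM j : `|zz N 0 j| <= M by apply: le_trans (coord_le_norm _ _) (CM _ Fz).
  have M0 : 0 <= M by apply: le_trans (normr_ge0 _) (CM _ Fz).
  case: (split_ordP k) => k' ->.
    by have := zM k'; rewrite mxE; lra.
  case/mxvec_indexP: k' => i j.
  have -> : N ord0 (rshift n (mxvec_index i j)) = LL N i j by rewrite !mxE.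
  have := CM _ (FN (delta_mx 0 i) _); rewrite d1 lexx => /(_ isT).
  move=> /(le_trans (coord_le_norm _ j)); rewrite -rowE !mxE => h.
  have := zM j; rewrite !mxE => h1.
  have := ler_normB (lsubmx N 0 j + LL N i j) (lsubmx N 0 j).
  by rewrite !mxE addrAC subrr add0r; lra.
pose L0 : 'M[R]_n := (e / 2)%:M.
pose pack z (L : 'M[R]_n) : 'rV[R]_(n + n * n) := row_mx z (mxvec L).
have packz z L : zz (pack z L) = z by rewrite /zz /pack row_mxKl.
have packL z L : LL (pack z L) = L by rewrite /LL /pack row_mxKr mxvecK.
have F0 : F (pack x0 L0).
  rewrite /F /= packz packL => u u1; apply: x0C; split=> // i j; rewrite ord1.
  rewrite /ball /= mul_mx_scalar !mxE opprD addrA subrr add0r normrN normrM.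
  have u2 : u 0 j ^+ 2 <= 1.
    apply: le_trans u1; rewrite dotE (bigD1 j) //= -expr2 lerDl sumr_ge0 // => k _.
    by rewrite -expr2 sqr_ge0.
  have : `|u 0 j| <= 1 by rewrite -(@expr_le1 _ 2) // real_normK ?num_real.
  by rewrite gtr0_norm ?divr_gt0 //; nra.
have cdet : continuous (fun N => \det (LL N)).
  have cprod (s : 'I_n -> 'I_n) : continuous (fun N => \prod_i LL N i (s i)).
    by apply: continuous_prod => i; apply: cLL.
  apply: continuous_sum => s N.
  exact: (continuousM (cst_continuous (x0 := N)) (cprod _ N)).
have [N /set_mem FN maxN] :=
  EVT_max_rV (ex_intro F _ F0) cF (continuous_subspaceT cdet).
exists (zz N), (LL N); split=> //.
  apply: lt_le_trans (maxN _ (mem_set F0)).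
  by rewrite packL det_scalar exprn_gt0 // divr_gt0.
move=> z' L' ins; have Fp : F (pack z' L') by rewrite /F /= packz packL.
by have := maxN _ (mem_set Fp); rewrite packL.
Qed.

(** * Return to the original coordinates *)

Lemma powR_3_2 (R : realType) (a : R) : 0 < a -> a `^ (3 / 2) = a * Num.sqrt a.
Proof.
move=> a0; have -> : 3 / 2 = 1 + 2^-1 :> R by field.
by rewrite powRD ?(gt_eqF a0) ?implybT // powRr1 ?powR12_sqrt // ltW.
Qed.

Theorem theorem1p3 (R : realType) :
  exists alpha c : R, [/\ 1 < alpha, 0 < c &
    forall (n : nat) (I : finType) (P : I -> set 'rV[R]_n),
      (forall i : I, convex_body (P i)) ->
      (\bigcap_(i in [set: I]) P i)° !=set0 ->
      exists (z : 'rV[R]_n) (s : nat) (i_ : 'I_s -> I),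
        s%:R <= alpha * n%:R /\
        translate z (\bigcap_(k in [set: 'I_s]) P (i_ k)) `<=`
          dilate (c * n%:R `^ (3 / 2))
            (translate z (\bigcap_(i in [set: I]) P i))].
Proof.
(* For [n >= 1], [40 n + n + 1 <= 42 n]. *)
exists 42, 200; split; [by lra|by lra|move=> n I P body Cint].
pose none : 'I_0 -> I := fun k => False_rect I (Bool.diff_false_true (ltn_ord k)).
have [n0|n0] := posnP n.
  subst n; exists 0, 0, none; split; first by rewrite mulr0.
  have [p /interior_subset Cp] := Cint.
  by move=> x _; exists (0 + p); [exists p|rewrite [LHS]thinmx0 [RHS]thinmx0].
have nR : 0 < n%:R :> R by rewrite ltr0n.
rewrite powR_3_2 //; set rho := 200 * _.
have rho0 : 0 < rho by rewrite !mulr_gt0 // sqrtr_gt0.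
have [i0|noI] := pselect (inhabited I); last first.
  (* For an empty family both intersections are the whole space. *)
  exists 0, 0, none; split; first by rewrite mulr_ge0 // ltW.
  move=> x _; exists (rho^-1 *: x); last by rewrite scalerA mulfV ?gt_eqF // scale1r.
  exists (rho^-1 *: x); last by rewrite add0r.
  by move=> i; case: noI; exists.
case: i0 => i0.
have sep i : point_separable (P i).
  have [cv cp [p /interior_subset Pp]] := body i.
  by apply: compact_convex_point_separable => //; exists p.
have cC : compact (\bigcap_(i in [set: I]) P i).
  have [_ cp _] := body i0; apply: subclosed_compact cp _ => [|x]; last by apply.
  apply: closed_bigI => i _; have [_ cpi _] := body i.
  exact: compact_closed (@norm_hausdorff _ _) cpi.
have [z [L [insC dL maxC]]] := exists_max_ellipsoid cC Cint.
have ins i : inscribed (P i) z L by move=> u u1; apply: insC.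
have maxL z' L' : (forall i, inscribed (P i) z' L') -> \det L' <= \det L.
  by move=> ins'; apply: (maxC z') => u u1 i _; apply: ins'.
have VT := max_ellipsoid_isotropic n0 sep ins dL maxL.
have V1 v : polar_normals P z L v -> dot v v <= 1 := polar_normals_le1 ins.
have V0 : polar_normals P z L 0 by exists i0 => u _; rewrite dot0l.
have [l [sl Vl lrho]] := sparse_polar n0 V1 VT V0.
(* Each selected polar point is assigned a body whose polar contains it; [i0] is a default outside
   [l]. *)
have [v|f fP] := @choice _ _
    (fun v i => v \in l -> forall u, P i (z + u *m L) -> dot v u <= 1).
  have [/Vl[i vi]|vl] := boolP (v \in l); first by exists i.
  by exists i0.
(* The translation by [- z] moves the centre of the ellipsoid to the origin, about which the
   dilation is taken. *)
exists (- z), (size l), (fun k => f (nth 0 l k)); split.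
  by rewrite sl -natrM ler_nat; lia.
move=> _ [y yP <-].
have uL : L \in unitmx by rewrite unitmxE unitfE gt_eqF.
pose u := (y - z) *m invmx L.
have uE : u *m L = - z + y by rewrite /u mulmxKV // addrC.
have uu : dot u u <= rho ^+ 2.
  apply: lrho => v vl; rewrite dotC; apply: fP => //.
  have vs : (index v l < size l)%N by rewrite index_mem.
  rewrite uE addrA subrr add0r -{1}(nth_index 0 vl).
  exact: (yP (Ordinal vs)).
exists (rho^-1 *: (u *m L)); last by rewrite scalerA mulfV ?gt_eqF // scale1r uE.
exists (z + (rho^-1 *: u) *m L); last by rewrite addKr -scalemxAl.
apply: insC; rewrite !dot_lin mulrA -expr2 exprVn mulrC ler_pdivrMr ?exprn_gt0 //.
by rewrite mul1r.
Qed.
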